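(* Let $S$ be a scheme, $G$ an $S$-group scheme, $X$ a $G$-scheme, and $\varphi:X\to Y$ a $G$-invariant morphism. If $\mathcal{O}_Y\to(\varphi_*\mathcal{O}_X)^G$ is an isomorphism, then $\varphi^*:\mathrm{Pic}(Y)\to\mathrm{Pic}(G,X)$ is injective.
   Context: A $G$-scheme is an $S$-scheme with a left $G$-action, with action $a:G\times X\to X$ and second projection $p_2:G\times X\to X$. A $G$-invariant morphism $\varphi:X\to Y$ is an $S$-morphism with $\varphi(gx)=\varphi(x)$ (i.e. $\varphi a=\varphi p_2$), $G$ acting trivially on $Y$. $(\varphi_*\mathcal{O}_X)^G\subset\varphi_*\mathcal{O}_X$ is the subsheaf whose sections over an open $V\subset Y$ are the $f\in\Gamma(\varphi^{-1}(V),\mathcal{O}_X)$ with $a^*f=p_2^*f$ in $\Gamma(G\times\varphi^{-1}(V),\mathcal{O})$. $\mathrm{Pic}(G,X)$ is the group (under tensor product over $\mathcal{O}_X$) of isomorphism classes of $G$-linearized invertible $\mathcal{O}_X$-modules (invertible sheaves with an isomorphism between the pullbacks under $a$ and $p_2$ satisfying the cocycle condition on $G\times G\times X$). The map $\varphi^*:\mathrm{Pic}(Y)\to\mathrm{Pic}(G,X)$ sends $[\mathcal{L}]$ to the class of $\varphi^*\mathcal{L}$ with the $G$-linearization pulled back from the trivial $G$-action on $\mathcal{L}$ (i.e. the one coming from $\varphi a=\varphi p_2$). *)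

(* Defs.v *)
From HB Require Import structures.
From mathcomp Require Import all_boot all_algebra.
From mathcomp Require Import all_classical.
From mathcomp Require Import topology.

Set Implicit Arguments.
Unset Strict Implicit.
Unset Printing Implicit Defensive.

Import GRing.Theory.
Local Open Scope classical_set_scope.
Local Open Scope ring_scope.

(** ** Open subsets and sheaves *)

Record opens (X : topologicalType) := Opens {
  oset : set X;
  oset_open : open oset }.

Section Opens.
Variable X : topologicalType.
Implicit Types U V W : opens X.

Definition osub V U : Prop := oset V `<=` oset U.

Definition oI U V : opens X := Opens (openI (oset_open U) (oset_open V)).

Lemma osub_refl U : osub U U. Proof. by []. Qed.
Lemma osub_trans V U W : osub W V -> osub V U -> osub W U.
Proof. by move=> h k x /h/k. Qed.
Lemma oIl U V : osub (oI U V) U. Proof. by move=> x []. Qed.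
Lemma oIr U V : osub (oI U V) V. Proof. by move=> x []. Qed.

Definition is_sheaf (F : opens X -> Type)
    (r : forall U V, osub V U -> F U -> F V) : Prop :=
  forall (U : opens X) (I : Type) (V : I -> opens X)
    (h : forall i, osub (V i) U),
    (forall x, oset U x -> exists i, oset (V i) x) ->
  forall s : forall i, F (V i),
    (forall i j, r _ _ (@oIl (V i) (V j)) (s i) = r _ _ (@oIr (V i) (V j)) (s j)) ->
  exists! t : F U, forall i, r _ _ (h i) t = s i.

End Opens.

Definition opre (X Y : topologicalType) (f : X -> Y) (cf : continuous f)
  (V : opens Y) : opens X :=
  Opens ((iffLR (continuousP f)) cf (oset V) (oset_open V)).

(** ** Ringed spaces *)

(* [comPzRingType] allows the zero ring, which is the ring of sections over
   the empty open set. *)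
Record ringedSpace := RingedSpace {
  rs_top :> topologicalType;
  sec : opens rs_top -> comPzRingType;
  res : forall U V, osub V U -> {rmorphism sec U -> sec V};
  res_id : forall U (h : osub U U) s, res h s = s;
  res_comp : forall U V W (h : osub V U) (k : osub W V) (l : osub W U) s,
    res k (res h s) = res l s;
  res_sheaf : is_sheaf (fun U V (h : osub V U) => res h : sec U -> sec V) }.

Lemma resE (X : ringedSpace) (U V W : opens X) (h : osub V U) (k : osub W V)
    (s : sec U) : res k (res h s) = res (osub_trans k h) s.
Proof. exact: res_comp. Qed.

Lemma res_irr (X : ringedSpace) (U V : opens X) (h k : osub V U) (s : sec U) :
  res h s = res k s.
Proof. by rewrite (Prop_irrelevance h k). Qed.

Record rsHom (X Y : ringedSpace) := RsHom {
  rs_fun :> X -> Y;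
  rs_cont : continuous rs_fun;
  rs_sharp : forall V : opens Y, {rmorphism sec V -> sec (opre rs_cont V)};
  rs_sharp_res : forall V W (h : osub W V)
      (k : osub (opre rs_cont W) (opre rs_cont V)) (s : sec V),
    rs_sharp W (res h s) = res k (rs_sharp V s) }.

Arguments rs_cont {X Y} r.

Definition rs_preim (X Y : ringedSpace) (f : rsHom X Y) (V : opens Y) : opens X :=
  opre (rs_cont f) V.

Lemma rs_preimS (X Y : ringedSpace) (f : rsHom X Y) (V W : opens Y) :
  osub W V -> osub (rs_preim f W) (rs_preim f V).
Proof. by move=> h x /h. Qed.

(* [U] and [V] are the same open set and [s], [t] the same section; needed
   because the preimages of an open set under two equal maps are only
   propositionally equal. *)
Definition sec_eq (X : ringedSpace) (U V : opens X) (s : sec U) (t : sec V) :=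
  osub U V /\ exists h : osub V U, res h s = t.

Definition rs_eq (X Y : ringedSpace) (f g : rsHom X Y) : Prop :=
  (forall x, f x = g x) /\
  (forall (V : opens Y) (s : sec V), sec_eq (rs_sharp f V s) (rs_sharp g V s)).

Notation "f =r g" := (rs_eq f g) (at level 70, no associativity).

Lemma sec_eq_refl (X : ringedSpace) (U : opens X) (s : sec U) : sec_eq s s.
Proof. by split; [|exists (osub_refl (U := U)); rewrite res_id]. Qed.

Lemma sec_eq_sym (X : ringedSpace) (U V : opens X) (s : sec U) (t : sec V) :
  sec_eq s t -> sec_eq t s.
Proof.
move=> [h [k <-]]; split=> //; exists h.
by rewrite (res_comp _ _ (osub_refl (U := U))) res_id.
Qed.

Lemma sec_eq_trans (X : ringedSpace) (U V W : opens X)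
    (s : sec U) (t : sec V) (r : sec W) :
  sec_eq s t -> sec_eq t r -> sec_eq s r.
Proof.
move=> [h [k <-]] [h' [k' <-]]; split; first exact: osub_trans h h'.
exists (osub_trans k' k).
by rewrite (res_comp _ _ (osub_trans k' k)).
Qed.

Lemma rs_eq_refl (X Y : ringedSpace) (f : rsHom X Y) : f =r f.
Proof. by split=> // V s; exact: sec_eq_refl. Qed.

Lemma rs_eq_sym (X Y : ringedSpace) (f g : rsHom X Y) : f =r g -> g =r f.
Proof.
by move=> [h k]; split=> [x|V s]; [rewrite h|exact: sec_eq_sym (k V s)].
Qed.

Lemma rs_eq_trans (X Y : ringedSpace) (f g h : rsHom X Y) :
  f =r g -> g =r h -> f =r h.
Proof.
move=> [e k] [e' k']; split=> [x|V s]; first by rewrite e e'.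
exact: sec_eq_trans (k V s) (k' V s).
Qed.

Lemma rs_eq_preim (X Y : ringedSpace) (f g : rsHom X Y) (V : opens Y) :
  f =r g -> osub (rs_preim f V) (rs_preim g V).
Proof. by move=> [e _] x /=; rewrite e. Qed.

Lemma rs_eq_sharp (X Y : ringedSpace) (f g : rsHom X Y) (e : f =r g)
    (V : opens Y) (s : sec V) (h : osub (rs_preim f V) (rs_preim g V)) :
  res h (rs_sharp g V s) = rs_sharp f V s.
Proof.
have [k [l <-]] := e.2 V s.
by rewrite (res_comp _ _ (osub_refl (U := rs_preim f V))) res_id.
Qed.

Section Comp.

Lemma id_cont (X : topologicalType) : continuous (fun x : X => x).
Proof. by apply/continuousP. Qed.

Definition rs_id_sharp (X : ringedSpace) (V : opens X) :
    {rmorphism sec V -> sec (opre (@id_cont X) V)} :=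
  res (V := opre (@id_cont X) V) (osub_refl (U := V)).

Lemma rs_id_sharp_res (X : ringedSpace) (V W : opens X) (h : osub W V)
    (k : osub (opre (@id_cont X) W) (opre (@id_cont X) V)) (s : sec V) :
  rs_id_sharp W (res h s) = res k (rs_id_sharp V s).
Proof. by rewrite /rs_id_sharp !resE; exact: res_irr. Qed.

Definition rs_id (X : ringedSpace) : rsHom X X := RsHom (@rs_id_sharp_res X).

Variables (X Y Z : ringedSpace) (g : rsHom Y Z) (f : rsHom X Y).

Lemma comp_cont : continuous (g \o f).
Proof.
by apply/continuousP => A oA; apply: (oset_open (rs_preim f (rs_preim g (Opens oA)))).
Qed.

Lemma comp_sub (V : opens Z) :
  osub (opre comp_cont V) (rs_preim f (rs_preim g V)).
Proof. by []. Qed.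

Definition rs_comp_sharp (V : opens Z) :
    {rmorphism sec V -> sec (opre comp_cont V)} :=
  res (comp_sub (V := V)) \o (rs_sharp f (rs_preim g V) \o rs_sharp g V).

Lemma rs_comp_sharp_res (V W : opens Z) (h : osub W V)
    (k : osub (opre comp_cont W) (opre comp_cont V)) (s : sec V) :
  rs_comp_sharp W (res h s) = res k (rs_comp_sharp V s).
Proof.
rewrite /rs_comp_sharp /= (rs_sharp_res _ (rs_preimS h)).
rewrite (rs_sharp_res _ (rs_preimS (rs_preimS h))).
by rewrite !resE; exact: res_irr.
Qed.

Definition rs_comp : rsHom X Z := RsHom rs_comp_sharp_res.

Lemma rs_compE (V : opens Z) (s : sec V) :
  rs_sharp rs_comp V s = res (comp_sub (V := V)) (rs_sharp f _ (rs_sharp g V s)).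
Proof. by []. Qed.

End Comp.

Notation "g \oR f" := (rs_comp g f) (at level 50, left associativity).

Lemma rs_comp_congr (X Y Z : ringedSpace) (g g' : rsHom Y Z) (f f' : rsHom X Y) :
  g =r g' -> f =r f' -> g \oR f =r g' \oR f'.
Proof.
move=> eg ef; split=> [x /=|V s]; first by rewrite ef.1 eg.1.
have h : osub (rs_preim (g \oR f) V) (rs_preim (g' \oR f') V).
  by move=> x /=; rewrite ef.1 eg.1.
split=> //.
have h' : osub (rs_preim (g' \oR f') V) (rs_preim (g \oR f) V).
  by move=> x /=; rewrite ef.1 eg.1.
exists h'.
rewrite !rs_compE.
have k := rs_eq_preim (V := V) eg.
rewrite -(rs_eq_sharp eg s k) (rs_sharp_res _ (rs_preimS k)).
have l := rs_eq_preim (V := rs_preim g' V) ef.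
by rewrite -(rs_eq_sharp ef _ l) !resE; exact: res_irr.
Qed.

(** ** Schemes *)

Record primeSpec (A : comPzRingType) := PrimeSpec {
  pr_ideal : A -> Prop;
  pr0 : pr_ideal 0;
  prD : forall a b, pr_ideal a -> pr_ideal b -> pr_ideal (a + b);
  prM : forall a b, pr_ideal b -> pr_ideal (a * b);
  pr1 : ~ pr_ideal 1;
  pr_prime : forall a b, pr_ideal (a * b) -> pr_ideal a \/ pr_ideal b }.

Definition zariski_open (A : comPzRingType) (W : set (primeSpec A)) : Prop :=
  exists E : set A, W = [set p | exists2 a, E a & ~ pr_ideal p a].

Section Zariski.
Variable A : comPzRingType.

HB.instance Definition _ := gen_eqMixin (primeSpec A).
HB.instance Definition _ := gen_choiceMixin (primeSpec A).

Lemma zariski_openT : @zariski_open A setT.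
Proof.
by exists [set 1]; apply/seteqP; split=> // p _; exists 1; [|exact: pr1].
Qed.

Lemma zariski_openI : setI_closed (@zariski_open A).
Proof.
move=> _ _ [E ->] [F ->]; exists [set c | exists a b, [/\ E a, F b & c = a * b]].
apply/seteqP; split=> p /=.
  move=> [[a Ea pa] [b Fb pb]]; exists (a * b); first by exists a, b.
  by case/pr_prime.
move=> [_ [a [b [Ea Fb ->]]] pab]; split; [exists a|exists b] => // h; apply: pab.
  by rewrite mulrC; exact: prM.
exact: prM.
Qed.

Lemma zariski_open_bigU (I : Type) (f : I -> set (primeSpec A)) :
  (forall i, zariski_open (f i)) -> zariski_open (\bigcup_i f i).
Proof.
move=> fo; exists [set a | exists i E,
  [/\ E a & f i = [set p | exists2 a, E a & ~ pr_ideal p a]]].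
apply/seteqP; split=> p /=.
  move=> [i _]; have [E fE] := fo i; rewrite fE => -[a Ea pa].
  by exists a => //; exists i, E.
by move=> [a [i [E [Ea fE]]] pa]; exists i => //; rewrite fE; exists a.
Qed.

HB.instance Definition _ := isOpenTopological.Build (primeSpec A)
  zariski_openT zariski_openI zariski_open_bigU.

End Zariski.

(* [theta] makes [B] a localization of [A] at the powers of [f]. *)
Definition is_localization_away (A B : comPzRingType) (f : A) (theta : A -> B) :=
  [/\ exists t, theta f * t = 1,
      forall b, exists a n, b * theta f ^+ n = theta a
    & forall a, theta a = 0 -> exists n, a * f ^+ n = 0].

(* The ringed space (U, O_X|_U) is isomorphic to Spec A for some ring A, via
   the homeomorphism [g]; the structure sheaf of Spec A is the sheaf whose
   sections over the basic open set D(f) are the localization A_f. *)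
Definition affine_open (X : ringedSpace) (U : opens X) : Prop :=
  exists (A : comPzRingType) (g : primeSpec A -> X) (theta : {rmorphism A -> sec U}),
    [/\ injective g,
        range g = oset U,
        forall W : set (primeSpec A), open W <-> open (g @` W)
      & forall (f : A) (V : opens X) (h : osub V U),
          oset V = g @` [set p | ~ pr_ideal p f] ->
          is_localization_away f (fun a => res h (theta a))].

Record scheme := Scheme {
  sch_rs :> ringedSpace;
  sch_affine : forall x : sch_rs, exists2 U : opens sch_rs,
    oset U x & affine_open U }.

(* The germ at [x] of the section [s] is a unit of the stalk at [x]. *)
Definition germ_unit (X : ringedSpace) (U : opens X) (s : sec U) (x : X) : Prop :=
  exists (W : opens X) (h : osub W U), oset W x /\ exists t, res h s * t = 1.

Definition local_hom (X Y : ringedSpace) (f : rsHom X Y) : Prop :=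
  forall (x : X) (V : opens Y) (s : sec V),
    oset V (f x) -> germ_unit (rs_sharp f V s) x -> germ_unit s (f x).

Record schHom (X Y : scheme) := SchHom {
  sh_rs :> rsHom X Y;
  sh_local : local_hom sh_rs }.

Lemma local_id (X : ringedSpace) : local_hom (rs_id X).
Proof.
move=> x V s Vx [W [h [Wx [t e]]]].
have k : osub W V by exact: h.
exists W, k; split=> //; exists t; rewrite -e /rs_id /= /rs_id_sharp resE.
by congr (_ * _); exact: res_irr.
Qed.

Lemma local_comp (X Y Z : ringedSpace) (g : rsHom Y Z) (f : rsHom X Y) :
  local_hom g -> local_hom f -> local_hom (g \oR f).
Proof.
move=> lg lf x V s Vx [W [h [Wx [t e]]]].
apply: lg => //; apply: lf => //.
exists W, (osub_trans h (comp_sub (V := V))); split=> //.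
by exists t; rewrite -e rs_compE resE.
Qed.

Definition sch_id (X : scheme) : schHom X X := SchHom (@local_id X).
Definition sch_comp (X Y Z : scheme) (g : schHom Y Z) (f : schHom X Y) :
  schHom X Z := SchHom (local_comp (@sh_local _ _ g) (@sh_local _ _ f)).

(** ** Schemes over a base scheme *)

Section Over.
Variable S : scheme.

Record overScheme := OverScheme {
  os_sch :> scheme;
  os_str : schHom os_sch S }.

Record overHom (X Y : overScheme) := OverHom {
  oh_sch :> schHom X Y;
  oh_str : os_str Y \oR oh_sch =r os_str X }.

Definition base : overScheme := OverScheme (sch_id S).

Lemma base_str (X : overScheme) : os_str base \oR os_str X =r os_str X.
Proof.
split=> // V s; split=> //; exists (fun x => id).
pose iV : osub (opre (@id_cont S) V) V := osub_refl (U := V).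
have e : rs_sharp (os_str X) _ (rs_sharp (os_str base) V s) =
    res (@rs_preimS _ _ (os_str X) _ _ iV) (rs_sharp (os_str X) V s).
  exact: (@rs_sharp_res _ _ (os_str X) _ _ iV (rs_preimS iV) s).
by rewrite rs_compE e !resE res_id.
Qed.

Definition to_base (X : overScheme) : overHom X base := OverHom (base_str X).

Lemma over_comp_str (X Y Z : overScheme) (g : overHom Y Z) (f : overHom X Y) :
  os_str Z \oR (sch_comp g f) =r os_str X.
Proof.
apply: rs_eq_trans (oh_str f).
apply: (@rs_eq_trans _ _ _ ((os_str Z \oR g) \oR f)); last first.
  by apply: rs_comp_congr; [exact: oh_str|exact: rs_eq_refl].
split=> // V s; split=> //; exists (fun x => id).
by rewrite !rs_compE /= (rs_sharp_res _ (rs_preimS (comp_sub (V := V)))) !resE;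
  exact: res_irr.
Qed.

Definition over_comp (X Y Z : overScheme) (g : overHom Y Z) (f : overHom X Y) :
  overHom X Z := OverHom (over_comp_str g f).

(* A fibre product of [X] and [Y] over [S], i.e. a product in the category of
   [S]-schemes. *)
Record fibreProduct (X Y : overScheme) := FibreProduct {
  fp_obj :> overScheme;
  fp1 : overHom fp_obj X;
  fp2 : overHom fp_obj Y;
  fp_pair : forall T : overScheme, overHom T X -> overHom T Y -> overHom T fp_obj;
  fp_pair1 : forall T (f : overHom T X) (g : overHom T Y),
    over_comp fp1 (fp_pair f g) =r f;
  fp_pair2 : forall T (f : overHom T X) (g : overHom T Y),
    over_comp fp2 (fp_pair f g) =r g;
  fp_uniq : forall T (u v : overHom T fp_obj),
    over_comp fp1 u =r over_comp fp1 v -> over_comp fp2 u =r over_comp fp2 v ->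
    u =r v }.

End Over.

Arguments fp1 {S X Y} _.
Arguments fp2 {S X Y} _.
Arguments fp_pair {S X Y} _ {T} _ _.

Notation "g \oS f" := (over_comp g f) (at level 50, left associativity).

(** ** Group schemes and their actions *)

(* The axioms are stated on T-valued points, for all S-schemes T. *)
Record groupScheme (S : scheme) := GroupScheme {
  gs_obj :> overScheme S;
  gs_sq : fibreProduct gs_obj gs_obj;
  gs_mul : overHom gs_sq gs_obj;
  gs_unit : overHom (base S) gs_obj;
  gs_inv : overHom gs_obj gs_obj;
  gs_mulA : forall (T : overScheme S) (x y z : overHom T gs_obj),
    gs_mul \oS fp_pair gs_sq (gs_mul \oS fp_pair gs_sq x y) z =r
    gs_mul \oS fp_pair gs_sq x (gs_mul \oS fp_pair gs_sq y z);
  gs_mul1g : forall (T : overScheme S) (x : overHom T gs_obj),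
    gs_mul \oS fp_pair gs_sq (gs_unit \oS to_base T) x =r x;
  gs_mulg1 : forall (T : overScheme S) (x : overHom T gs_obj),
    gs_mul \oS fp_pair gs_sq x (gs_unit \oS to_base T) =r x;
  gs_mulVg : forall (T : overScheme S) (x : overHom T gs_obj),
    gs_mul \oS fp_pair gs_sq (gs_inv \oS x) x =r gs_unit \oS to_base T;
  gs_mulgV : forall (T : overScheme S) (x : overHom T gs_obj),
    gs_mul \oS fp_pair gs_sq x (gs_inv \oS x) =r gs_unit \oS to_base T }.

Record GScheme (S : scheme) (G : groupScheme S) := GSchemeMk {
  ga_obj :> overScheme S;
  (* G x X and G x (G x X) *)
  ga_prod : fibreProduct G ga_obj;
  ga_prod3 : fibreProduct G ga_prod;
  ga_act : overHom ga_prod ga_obj;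
  ga_actA : forall (T : overScheme S) (g h : overHom T G) (x : overHom T ga_obj),
    ga_act \oS fp_pair ga_prod (gs_mul G \oS fp_pair (gs_sq G) g h) x =r
    ga_act \oS fp_pair ga_prod g (ga_act \oS fp_pair ga_prod h x);
  ga_act1 : forall (T : overScheme S) (x : overHom T ga_obj),
    ga_act \oS fp_pair ga_prod (gs_unit G \oS to_base T) x =r x }.

Definition ga_p2 (S : scheme) (G : groupScheme S) (X : GScheme G) :
  overHom (ga_prod X) X := fp2 (ga_prod X).

Section TripleProduct.
Variables (S : scheme) (G : groupScheme S) (X : GScheme G).

(* (g, h, x) |-> (gh, x) *)
Definition ga_mul1 : overHom (ga_prod3 X) (ga_prod X) :=
  fp_pair (ga_prod X)
    (gs_mul G \oS fp_pair (gs_sq G) (fp1 (ga_prod3 X))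
                                   (fp1 (ga_prod X) \oS fp2 (ga_prod3 X)))
    (fp2 (ga_prod X) \oS fp2 (ga_prod3 X)).

(* (g, h, x) |-> (g, hx) *)
Definition ga_1act : overHom (ga_prod3 X) (ga_prod X) :=
  fp_pair (ga_prod X) (fp1 (ga_prod3 X)) (ga_act X \oS fp2 (ga_prod3 X)).

(* (g, h, x) |-> (h, x) *)
Definition ga_p23 : overHom (ga_prod3 X) (ga_prod X) := fp2 (ga_prod3 X).

Lemma ga_mul1_act : ga_act X \oR ga_mul1 =r ga_act X \oR ga_1act.
Proof.
apply: rs_eq_trans (ga_actA _ _ _) _.
apply: rs_comp_congr; first exact: rs_eq_refl.
apply: fp_uniq; first exact: rs_eq_trans (fp_pair1 _ _ _) (rs_eq_sym (fp_pair1 _ _ _)).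
apply: rs_eq_trans (fp_pair2 _ _ _) _.
apply: rs_eq_trans _ (rs_eq_sym (fp_pair2 _ _ _)).
apply: rs_comp_congr; first exact: rs_eq_refl.
apply: fp_uniq; first exact: fp_pair1.
exact: fp_pair2.
Qed.

Lemma ga_1act_p2 : ga_p2 X \oR ga_1act =r ga_act X \oR ga_p23.
Proof. exact: fp_pair2. Qed.

Lemma ga_mul1_p2 : ga_p2 X \oR ga_mul1 =r ga_p2 X \oR ga_p23.
Proof. exact: fp_pair2. Qed.

End TripleProduct.

(** ** Invariant morphisms *)

Definition G_invariant (S : scheme) (G : groupScheme S) (X : GScheme G)
    (Y : overScheme S) (phi : overHom X Y) : Prop :=
  phi \oR ga_act X =r phi \oR ga_p2 X.

Section Invariants.
Variables (S : scheme) (G : groupScheme S) (X : GScheme G) (Y : overScheme S).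
Variables (phi : overHom X Y).

(* [f] in Gamma(phi^-1(V), O_X) with a^* f = p_2^* f; for invariant [phi] both
   a^-1(phi^-1(V)) and p_2^-1(phi^-1(V)) are the open set G x phi^-1(V). *)
Definition invariant_section (V : opens Y) (f : sec (rs_preim phi V)) : Prop :=
  sec_eq (rs_sharp (ga_act X) _ f) (rs_sharp (ga_p2 X) _ f).

(* O_Y -> (phi_* O_X)^G is an isomorphism of sheaves, i.e. bijective on
   sections over every open set. *)
Definition invariants_iso : Prop :=
  forall V : opens Y, injective (rs_sharp phi V) /\
    forall f : sec (rs_preim phi V),
      invariant_section f <-> exists b : sec V, rs_sharp phi V b = f.

End Invariants.

(** ** Sheaves of modules *)

Record omodule (X : ringedSpace) := OModule {
  msec : forall U : opens X, lmodType (sec U);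
  mres : forall U V, osub V U -> msec U -> msec V;
  mres_linear : forall U V (h : osub V U) (a : sec U) (u v : msec U),
    mres h (a *: u + v) = res h a *: mres h u + mres h v;
  mres_id : forall U (h : osub U U) s, mres h s = s;
  mres_comp : forall U V W (h : osub V U) (k : osub W V) (l : osub W U) s,
    mres k (mres h s) = mres l s;
  mres_sheaf : is_sheaf mres }.

Section OModuleTheory.
Variables (X : ringedSpace) (M : omodule X).
Implicit Types U V W : opens X.

Lemma mresE U V W (h : osub V U) (k : osub W V) (s : msec M U) :
  mres k (mres h s) = mres (osub_trans k h) s.
Proof. exact: mres_comp. Qed.

Lemma mres_irr U V (h k : osub V U) (s : msec M U) : mres h s = mres k s.
Proof. by rewrite (Prop_irrelevance h k). Qed.

Lemma mresD U V (h : osub V U) (s t : msec M U) :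
  mres h (s + t) = mres h s + mres h t.
Proof. by rewrite -[s]scale1r mres_linear rmorph1 !scale1r. Qed.

Lemma mres0 U V (h : osub V U) : mres h (0 : msec M U) = 0.
Proof. by apply: (@addrI _ (mres h 0)); rewrite -mresD !addr0. Qed.

Lemma mresZ U V (h : osub V U) a (s : msec M U) :
  mres h (a *: s) = res h a *: mres h s.
Proof. by rewrite -[a *: s]addr0 mres_linear mres0 addr0. Qed.

Lemma mres_sep U (s t : msec M U) :
  (forall x, oset U x -> exists V (h : osub V U), oset V x /\ mres h s = mres h t) ->
  s = t.
Proof.
move=> loc.
pose I := {V : opens X & {h : osub V U | mres h s = mres h t}}.
have [] := @mres_sheaf _ M U I (@projT1 _ _) (fun i => sval (projT2 i)) _
  (fun i => mres (sval (projT2 i)) s).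
- move=> x /loc[V [h [Vx e]]].
  by exists (existT _ V (exist _ h e)).
- by move=> i j; rewrite !mresE; exact: mres_irr.
move=> r [_ ru]; rewrite -(ru s) // -(ru t) // => i.
by rewrite (svalP (projT2 i)).
Qed.

End OModuleTheory.

Section OStr.
Variable X : ringedSpace.

Lemma ostr_linear (U V : opens X) (h : osub V U) (a : sec U) (u v : (sec U)^o) :
  (res h (a *: u + v) : (sec V)^o) = res h a *: (res h u : (sec V)^o) + res h v.
Proof. by rewrite rmorphD rmorphM. Qed.

Definition ostr : omodule X :=
  @OModule X (fun U => (sec U)^o : lmodType (sec U)) (fun U V h => res h)
    ostr_linear (@res_id X) (@res_comp X) (@res_sheaf X).

End OStr.

(** ** Morphisms of modules *)

Record modHom (X : ringedSpace) (M N : omodule X) := ModHom {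
  mh_fun :> forall U, msec M U -> msec N U;
  mh_linear : forall U, linear (@mh_fun U);
  mh_res : forall U V (h : osub V U) (s : msec M U),
    mh_fun (mres h s) = mres h (mh_fun s) }.

Definition mh_eq (X : ringedSpace) (M N : omodule X) (f g : modHom M N) : Prop :=
  forall U (s : msec M U), f U s = g U s.

Notation "f =m g" := (mh_eq f g) (at level 70, no associativity).

Section ModHom.
Variable X : ringedSpace.

Lemma mhD (M N : omodule X) (f : modHom M N) U (s t : msec M U) :
  f U (s + t) = f U s + f U t.
Proof. by rewrite -[s]scale1r mh_linear !scale1r. Qed.

Lemma mh0 (M N : omodule X) (f : modHom M N) U : f U 0 = 0.
Proof. by apply: (@addrI _ (f U 0)); rewrite -mhD !addr0. Qed.

Lemma mhZ (M N : omodule X) (f : modHom M N) U a (s : msec M U) :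
  f U (a *: s) = a *: f U s.
Proof. by rewrite -[a *: s]addr0 mh_linear mh0 addr0. Qed.

Definition mh_id (M : omodule X) : modHom M M :=
  @ModHom X M M (fun U s => s) (fun U a u v => erefl) (fun U V h s => erefl).

Section Comp.
Variables (M N P : omodule X) (g : modHom N P) (f : modHom M N).

Lemma mh_comp_linear U : linear (fun s => g U (f U s)).
Proof. by move=> a u v; rewrite !mh_linear. Qed.

Lemma mh_comp_res U V (h : osub V U) (s : msec M U) :
  g V (f V (mres h s)) = mres h (g U (f U s)).
Proof. by rewrite !mh_res. Qed.

Definition mh_comp : modHom M P := ModHom mh_comp_linear mh_comp_res.
End Comp.

Definition mh_iso (M N : omodule X) (f : modHom M N) : Prop :=
  exists g : modHom N M, mh_comp g f =m mh_id M /\ mh_comp f g =m mh_id N.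

(* Morphisms M|_W -> N|_W over an open set W. *)
Record modHomOn (W : opens X) (M N : omodule X) := ModHomOn {
  mho_fun :> forall U, osub U W -> msec M U -> msec N U;
  mho_linear : forall U (h : osub U W), linear (mho_fun h);
  mho_res : forall U V (k : osub U W) (l : osub V W) (h : osub V U) (s : msec M U),
    mho_fun l (mres h s) = mres h (mho_fun k s) }.

Definition invertible (M : omodule X) : Prop :=
  forall x : X, exists W : opens X, oset W x /\
    exists f : modHomOn W (ostr X) M, forall U (h : osub U W), bijective (f U h).

End ModHom.

Notation "g \oM f" := (mh_comp g f) (at level 50, left associativity).

(** ** Direct and inverse images *)

Definition restrict_scalars (R S : pzRingType) (f : {rmorphism R -> S})
  (N : lmodType S) : Type := N.

Section RestrictScalars.
Variables (R S : pzRingType) (f : {rmorphism R -> S}) (N : lmodType S).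
Notation rN := (restrict_scalars f N).

HB.instance Definition _ := GRing.Zmodule.copy rN N.

Definition rscale (a : R) (v : rN) : rN :=
  f a *: (v : N).

Lemma rscaleA a b v : rscale a (rscale b v) = rscale (a * b) v.
Proof. by rewrite /rscale scalerA rmorphM. Qed.
Lemma rscale1 : left_id 1 rscale.
Proof. by move=> v; rewrite /rscale rmorph1 scale1r. Qed.
Lemma rscaleDr : right_distributive rscale +%R.
Proof. by move=> a u v; exact: scalerDr. Qed.
Lemma rscaleDl v : {morph rscale^~ v : a b / a + b}.
Proof. by move=> a b; rewrite /rscale rmorphD; exact: scalerDl. Qed.

HB.instance Definition _ := GRing.Zmodule_isLmodule.Build R rN
  rscaleA rscale1 rscaleDr rscaleDl.
End RestrictScalars.

Section Pushforward.
Variables (X Y : ringedSpace) (f : rsHom X Y) (N : omodule X).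

Definition push_sec (V : opens Y) : lmodType (sec V) :=
  restrict_scalars (rs_sharp f V) (msec N (rs_preim f V)).

Definition push_res (U V : opens Y) (h : osub V U) (s : push_sec U) : push_sec V :=
  mres (rs_preimS h) (s : msec N (rs_preim f U)).

Lemma push_linear (U V : opens Y) (h : osub V U) (a : sec U) (u v : push_sec U) :
  push_res h (a *: u + v) = res h a *: push_res h u + push_res h v.
Proof.
apply: etrans (mres_linear _ _ _ _) _.
by rewrite -(rs_sharp_res h).
Qed.

Lemma push_id (U : opens Y) (h : osub U U) (s : push_sec U) : push_res h s = s.
Proof. exact: mres_id. Qed.

Lemma push_comp (U V W : opens Y) (h : osub V U) (k : osub W V) (l : osub W U)
  (s : push_sec U) : push_res k (push_res h s) = push_res l s.
Proof. exact: mres_comp. Qed.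

Lemma push_sheaf : is_sheaf push_res.
Proof.
move=> U I V h cov s comp.
apply: (@mres_sheaf _ N (rs_preim f U) I (fun i => rs_preim f (V i))
  (fun i => rs_preimS (h i)) _ s); first by move=> x /cov.
move=> i j; move: (comp i j); rewrite /push_res => e.
have k : osub (oI (rs_preim f (V i)) (rs_preim f (V j))) (rs_preim f (oI (V i) (V j))).
  by [].
by have := congr1 (mres k) e; rewrite !mresE (mres_irr _ (@oIl _ _ _))
  (mres_irr _ (@oIr _ _ _)).
Qed.

Definition pushforward : omodule Y :=
  OModule push_linear push_id push_comp push_sheaf.

End Pushforward.

Section PushHom.
Variables (X Y : ringedSpace) (f : rsHom X Y) (N P : omodule X) (g : modHom N P).

Definition push_hom_fun (V : opens Y) (s : msec (pushforward f N) V) :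
  msec (pushforward f P) V := g (rs_preim f V) s.
Lemma push_hom_linear V : linear (@push_hom_fun V).
Proof. by move=> a u v; exact: (mh_linear g). Qed.
Lemma push_hom_res U V (h : osub V U) (s : msec (pushforward f N) U) :
  push_hom_fun (mres h s) = mres h (push_hom_fun s).
Proof. exact: (mh_res g). Qed.
Definition push_hom : modHom (pushforward f N) (pushforward f P) :=
  ModHom push_hom_linear push_hom_res.
End PushHom.

(* [P] is an inverse image f^* M: the functor f^* is left adjoint to f_*, and
   [pb_unit] is the unit M -> f_* f^* M of the adjunction at [M]. *)
Record inverseImage (X Y : ringedSpace) (f : rsHom X Y) (M : omodule Y) := InverseImage {
  pb_mod :> omodule X;
  pb_unit : modHom M (pushforward f pb_mod);
  pb_lift : forall N : omodule X, modHom M (pushforward f N) -> modHom pb_mod N;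
  pb_liftK : forall N (k : modHom M (pushforward f N)),
    push_hom f (pb_lift k) \oM pb_unit =m k;
  pb_uniq : forall N (g h : modHom pb_mod N),
    push_hom f g \oM pb_unit =m push_hom f h \oM pb_unit -> g =m h }.

(** ** Existence of inverse images *)

(* A section of f^* M over [U] is locally a finite sum of a (x) s, with [a] a
   section of O_X and [s] a section of [M].  Two such sums are identified when
   they agree in every O_X-module [N] under every morphism M -> f_* N, so that a
   section over [U] is a locally representable family of values in all [N]; it
   is encoded by the set of all local sums which represent it. *)
Section InverseImage.
Variables (X Y : ringedSpace) (f : rsHom X Y) (M : omodule Y).

Record iterm (W : opens X) := ITerm {
  it_coef : sec W;
  it_open : opens Y;
  it_sub : osub W (rs_preim f it_open);
  it_sec : msec M it_open }.

Definition iexpr W := seq (iterm W).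

Notation target N := (modHom M (pushforward f N)).

Definition at_pre (N : omodule X) (k : target N) (V : opens Y) (s : msec M V) :
  msec N (rs_preim f V) := k V s.

Definition iev (N : omodule X) (k : target N) W (e : iexpr W) : msec N W :=
  \sum_(t <- e) it_coef t *: mres (it_sub t) (at_pre k (it_sec t)).

Definition ires W W' (h : osub W' W) (e : iexpr W) : iexpr W' :=
  [seq ITerm (res h (it_coef t)) (osub_trans h (it_sub t)) (it_sec t) | t <- e].

Lemma iev_res N (k : target N) W W' (h : osub W' W) (e : iexpr W) :
  iev k (ires h e) = mres h (iev k e).
Proof.
rewrite /iev /ires; elim: e => [|t e ih]; first by rewrite !big_nil mres0.
by rewrite /= !big_cons ih mresD mresZ mresE.
Qed.

Definition iscale W (a : sec W) (e : iexpr W) : iexpr W :=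
  [seq ITerm (a * it_coef t) (it_sub t) (it_sec t) | t <- e].

Lemma iev_scale N (k : target N) W (a : sec W) (e : iexpr W) :
  iev k (iscale a e) = a *: iev k e.
Proof.
rewrite /iev /iscale; elim: e => [|t e ih]; first by rewrite !big_nil scaler0.
by rewrite /= !big_cons ih scalerDr scalerA.
Qed.

Lemma iev_cat N (k : target N) W (e e' : iexpr W) :
  iev k (e ++ e') = iev k e + iev k e'.
Proof. by rewrite /iev big_cat. Qed.

Definition ifam U := forall N, target N -> msec N U.

Definition irep U (t : ifam U) W (e : iexpr W) : Prop :=
  exists h : osub W U, forall N (k : target N), iev k e = mres h (t N k).

Definition iloc U (t : ifam U) : Prop :=
  forall x, oset U x -> exists W, exists2 e : iexpr W, oset W x & irep t e.

Record isec (U : opens X) := ISec {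
  is_graph : forall W, iexpr W -> Prop;
  is_graphP : exists2 t : ifam U, iloc t & is_graph = irep t }.

Definition ival U (s : isec U) : ifam U := s2val (cid2 (is_graphP s)).

Lemma ival_loc U (s : isec U) : iloc (ival s).
Proof. by rewrite /ival; case: cid2. Qed.

Lemma ival_graph U (s : isec U) : is_graph s = irep (ival s).
Proof. by rewrite /ival; case: cid2. Qed.

Lemma isec_ext U (s s' : isec U) :
  (forall N (k : target N), ival s k = ival s' k) -> s = s'.
Proof.
move=> e; have : is_graph s = is_graph s'.
  rewrite !ival_graph; apply: functional_extensionality_dep => W; apply/funext => x; apply/propext.
  by split=> -[h hx]; exists h => N k; rewrite hx e.
case: s s' {e} => [g gP] [g' gP'] /= e; case: _ / e gP' => gP'.
by rewrite (Prop_irrelevance gP gP').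
Qed.

Lemma irep_inj U (t t' : ifam U) : iloc t ->
  (forall W (e : iexpr W), irep t e -> irep t' e) ->
  forall N (k : target N), t N k = t' N k.
Proof.
move=> lt sub N k; apply: mres_sep => x /lt[W [e Wx te]].
have [h' t'e] := sub _ _ te; have [h he] := te.
by exists W, h; split=> //; rewrite -he t'e; exact: mres_irr.
Qed.

Definition imk U (t : ifam U) (lt : iloc t) : isec U :=
  ISec (ex_intro2 _ _ t lt erefl).

Lemma imkK U (t : ifam U) (lt : iloc t) N (k : target N) : ival (imk lt) k = t N k.
Proof.
apply: irep_inj; first exact: ival_loc.
by move=> W e; rewrite -ival_graph.
Qed.

HB.instance Definition _ U := gen_eqMixin (isec U).
HB.instance Definition _ U := gen_choiceMixin (isec U).

Lemma iloc0 U : iloc (fun N (k : target N) => 0 : msec N U).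
Proof.
move=> x Ux; exists U, [::] => //; exists (osub_refl (U := U)) => N k.
by rewrite mres0 /iev big_nil.
Qed.

Lemma ilocD U (t t' : ifam U) :
  iloc t -> iloc t' -> iloc (fun N k => t N k + t' N k).
Proof.
move=> lt lt' x Ux; have [W [e Wx [h he]]] := lt x Ux.
have [W' [e' Wx' [h' he']]] := lt' x Ux.
exists (oI W W'), (ires (@oIl _ W W') e ++ ires (@oIr _ W W') e') => //.
exists (osub_trans (@oIl _ W W') h) => N k.
rewrite iev_cat !iev_res he he' !mresE mresD; congr (_ + _); exact: mres_irr.
Qed.

Lemma ilocZ U (a : sec U) (t : ifam U) : iloc t -> iloc (fun N k => a *: t N k).
Proof.
move=> lt x Ux; have [W [e Wx [h he]]] := lt x Ux.
exists W, (iscale (res h a) e) => //; exists h => N k.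
by rewrite iev_scale he mresZ.
Qed.

Lemma iloc_res U V (h : osub V U) (t : ifam U) :
  iloc t -> iloc (fun N k => mres h (t N k)).
Proof.
move=> lt x Vx; have [W [e Wx [l le]]] := lt x (h x Vx).
exists (oI W V), (ires (@oIl _ W V) e) => //; exists (@oIr _ W V) => N k.
by rewrite iev_res le !mresE; exact: mres_irr.
Qed.

Definition isec0 U : isec U := imk (@iloc0 U).
Definition isecD U (s s' : isec U) : isec U := imk (ilocD (ival_loc s) (ival_loc s')).
Definition isecZ U (a : sec U) (s : isec U) : isec U := imk (ilocZ a (ival_loc s)).
Definition isecN U (s : isec U) : isec U := isecZ (-1) s.
Definition isec_res U V (h : osub V U) (s : isec U) : isec V :=
  imk (iloc_res h (ival_loc s)).

Lemma isecDA U : associative (@isecD U).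
Proof. by move=> s t r; apply: isec_ext => N k; rewrite !imkK addrA. Qed.
Lemma isecDC U : commutative (@isecD U).
Proof. by move=> s t; apply: isec_ext => N k; rewrite !imkK addrC. Qed.
Lemma isecD0 U : left_id (isec0 U) (@isecD U).
Proof. by move=> s; apply: isec_ext => N k; rewrite !imkK add0r. Qed.
Lemma isecDN U : left_inverse (isec0 U) (@isecN U) (@isecD U).
Proof. by move=> s; apply: isec_ext => N k; rewrite !imkK scaleN1r addNr. Qed.

HB.instance Definition _ U := GRing.isZmodule.Build (isec U)
  (@isecDA U) (@isecDC U) (@isecD0 U) (@isecDN U).

Lemma isecZA U a b (s : isec U) : isecZ a (isecZ b s) = isecZ (a * b) s.
Proof. by apply: isec_ext => N k; rewrite !imkK scalerA. Qed.
Lemma isecZ1 U : left_id 1 (@isecZ U).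
Proof. by move=> s; apply: isec_ext => N k; rewrite !imkK scale1r. Qed.
Lemma isecZDr U : right_distributive (@isecZ U) +%R.
Proof. by move=> a s t; apply: isec_ext => N k; rewrite !imkK scalerDr. Qed.
Lemma isecZDl U (s : isec U) : {morph (@isecZ U)^~ s : a b / a + b}.
Proof. by move=> a b; apply: isec_ext => N k; rewrite !imkK scalerDl. Qed.

HB.instance Definition _ U := GRing.Zmodule_isLmodule.Build (sec U) (isec U)
  (@isecZA U) (@isecZ1 U) (@isecZDr U) (@isecZDl U).

Lemma ivalP U (a : sec U) (s t : isec U) N (k : target N) :
  ival (a *: s + t) k = a *: ival s k + ival t k.
Proof. by rewrite !imkK. Qed.

Lemma ires_linear U V (h : osub V U) (a : sec U) (s t : isec U) :
  isec_res h (a *: s + t) = res h a *: isec_res h s + isec_res h t.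
Proof. by apply: isec_ext => N k; rewrite !(imkK, ivalP) mres_linear. Qed.

Lemma ires_id U (h : osub U U) (s : isec U) : isec_res h s = s.
Proof. by apply: isec_ext => N k; rewrite imkK mres_id. Qed.

Lemma ires_comp U V W (h : osub V U) (k : osub W V) (l : osub W U) (s : isec U) :
  isec_res k (isec_res h s) = isec_res l s.
Proof. by apply: isec_ext => N j; rewrite !imkK mresE; exact: mres_irr. Qed.

Lemma ires_sheaf : is_sheaf isec_res.
Proof.
move=> U I V h cov s comp.
have glue N (k : target N) := @mres_sheaf _ N U I V h cov (fun i => ival (s i) k).
have {}glue N (k : target N) : exists! t, forall i, mres (h i) t = ival (s i) k.
  apply: glue => i j; move: (congr1 (fun t => ival t k) (comp i j)).
  by rewrite !imkK.
pose t N (k : target N) := sval (cid (glue N k)).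
have tP N (k : target N) i : mres (h i) (t N k) = ival (s i) k.
  by rewrite /t; case: cid => /= ? [+ _]; apply.
have tu N (k : target N) r : (forall i, mres (h i) r = ival (s i) k) -> t N k = r.
  by rewrite /t; case: cid => /= ? [_ +]; apply.
have lt : iloc t.
  move=> x /cov[i Vx]; have [W [e Wx [l le]]] := ival_loc (s i) Vx.
  exists W, e => //; exists (osub_trans l (h i)) => N k.
  by rewrite le -tP mresE.
exists (imk lt); split=> [i|r rP]; apply: isec_ext => N k; rewrite !imkK //.
by apply: tu => i; rewrite -rP imkK.
Qed.

Definition inv_mod : omodule X :=
  OModule ires_linear ires_id ires_comp ires_sheaf.

Lemma iloc_unit V (s : msec M V) : iloc (fun N (k : target N) => at_pre k s).
Proof.
move=> x Vx; exists (rs_preim f V), [:: ITerm 1 (osub_refl (U := rs_preim f V)) s] => //.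
exists (osub_refl (U := rs_preim f V)) => N k.
by rewrite /iev big_seq1 scale1r.
Qed.

Definition iunit_fun V (s : msec M V) : msec (pushforward f inv_mod) V :=
  imk (iloc_unit s).

Lemma iunit_linear V : linear (@iunit_fun V).
Proof.
move=> a s t; apply: isec_ext => N k.
by rewrite (ivalP (rs_sharp f V a)) !imkK; exact: (mh_linear k).
Qed.

Lemma iunit_res U V (h : osub V U) (s : msec M U) :
  iunit_fun (mres h s) = mres h (iunit_fun s).
Proof.
by apply: isec_ext => N k; rewrite !imkK; exact: (mh_res k).
Qed.

Definition iunit : modHom M (pushforward f inv_mod) :=
  ModHom iunit_linear iunit_res.

Section Lift.
Variables (N : omodule X) (k : target N).
Definition ilift_fun U (s : msec inv_mod U) : msec N U := ival s k.
Lemma ilift_linear U : linear (@ilift_fun U).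
Proof. by move=> a s t; exact: ivalP. Qed.
Lemma ilift_res U V (h : osub V U) (s : msec inv_mod U) :
  ilift_fun (mres h s) = mres h (ilift_fun s).
Proof. exact: imkK. Qed.
Definition ilift : modHom inv_mod N := ModHom ilift_linear ilift_res.

Lemma iliftK : push_hom f ilift \oM iunit =m k.
Proof. by move=> V s; exact: imkK. Qed.
End Lift.

Lemma iuniq N (g h : modHom inv_mod N) :
  push_hom f g \oM iunit =m push_hom f h \oM iunit -> g =m h.
Proof.
move=> e U s; apply: mres_sep => x Ux.
have [W [ex Wx [l le]]] := ival_loc s Ux.
exists W, l; split=> //; rewrite -!mh_res.
have -> : mres l s = iev iunit ex.
  apply: isec_ext => N' k'; rewrite imkK -le.
  change (iev k' ex = ilift k' W (iev iunit ex)).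
  rewrite /iev; elim: (ex) => [|t r ih]; first by rewrite !big_nil mh0.
  by rewrite !big_cons mhD mhZ mh_res -ih; congr (_ *: mres _ _ + _); rewrite /at_pre -(iliftK k').
rewrite /iev; elim: (ex) => [|t r ih]; first by rewrite !big_nil !mh0.
by rewrite !big_cons !mhD !mhZ !mh_res ih; congr (_ *: mres _ _ + _); exact: e.
Qed.

Definition inverse_image : inverseImage f M := InverseImage iliftK iuniq.

End InverseImage.

Global Opaque inverse_image.

Section InverseImageTheory.
Variables (X Y : ringedSpace) (f : rsHom X Y).

Definition inv_sec (M : omodule Y) V (s : msec M V) :
  msec (inverse_image f M) (rs_preim f V) := pb_unit (inverse_image f M) V s.

Lemma inv_sec_res (M : omodule Y) U V (h : osub V U) (s : msec M U)
    (k : osub (rs_preim f V) (rs_preim f U)) :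
  inv_sec (mres h s) = mres k (inv_sec s).
Proof. by rewrite /inv_sec mh_res; exact: mres_irr. Qed.

Lemma inv_sec_linear (M : omodule Y) V (a : sec V) (s t : msec M V) :
  inv_sec (a *: s + t) = rs_sharp f V a *: inv_sec s + inv_sec t.
Proof. exact: (mh_linear (pb_unit (inverse_image f M))). Qed.

Lemma inv_secZ (M : omodule Y) V (a : sec V) (s : msec M V) :
  inv_sec (a *: s) = rs_sharp f V a *: inv_sec s.
Proof. exact: (mhZ (pb_unit (inverse_image f M))). Qed.

Lemma inv_sec_ext (M : omodule Y) (N : omodule X) (g h : modHom (inverse_image f M) N) :
  (forall V (s : msec M V), g _ (inv_sec s) = h _ (inv_sec s)) -> g =m h.
Proof. by move=> e; apply: (@pb_uniq _ _ _ _ (inverse_image f M)) => V s; exact: e. Qed.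

Lemma pb_liftE (M : omodule Y) (N : omodule X) (k : modHom M (pushforward f N))
    V (s : msec M V) :
  pb_lift (inverse_image f M) k _ (inv_sec s) = k V s.
Proof. exact: (@pb_liftK _ _ _ _ (inverse_image f M) N k V s). Qed.

Definition inv_map (M N : omodule Y) (h : modHom M N) :
    modHom (inverse_image f M) (inverse_image f N) :=
  pb_lift (inverse_image f M) (pb_unit (inverse_image f N) \oM h).

Lemma inv_mapE (M N : omodule Y) (h : modHom M N) V (s : msec M V) :
  inv_map h _ (inv_sec s) = inv_sec (h V s).
Proof. exact: pb_liftE. Qed.

End InverseImageTheory.

(* The canonical isomorphism u^* f^* M -> v^* g^* M when f u = g v: it maps the
   inverse image of a local section of [M] to its inverse image. *)
Section Canonical.
Variables (T A B X : ringedSpace).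
Variables (f : rsHom A X) (u : rsHom T A) (g : rsHom B X) (v : rsHom T B).
Hypothesis e : f \oR u =r g \oR v.
Variable M : omodule X.

Lemma canon_sub V :
  osub (rs_preim u (rs_preim f V)) (rs_preim v (rs_preim g V)).
Proof. by move=> x; have := rs_eq_preim (V := V) e; apply. Qed.

Definition canon_fun V (s : msec M V) :
    msec (pushforward f (pushforward u (inverse_image v (inverse_image g M)))) V :=
  mres (@canon_sub V) (inv_sec v (inv_sec g s)).

Lemma canon_sharp V (a : sec V) :
  res (@canon_sub V) (rs_sharp v _ (rs_sharp g V a)) = rs_sharp u _ (rs_sharp f V a).
Proof.
have := rs_eq_sharp e a (rs_eq_preim (V := V) e); rewrite !rs_compE.
have k : osub (rs_preim u (rs_preim f V)) (rs_preim (f \oR u) V) by [].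
move/(congr1 (res k)); rewrite !resE res_id => <-; exact: res_irr.
Qed.

Lemma canon_linear V : linear (@canon_fun V).
Proof.
move=> a s t; rewrite /canon_fun !inv_sec_linear mres_linear canon_sharp.
by [].
Qed.

Lemma canon_res U V (h : osub V U) (s : msec M U) :
  canon_fun (mres h s) = mres h (canon_fun s).
Proof.
rewrite /canon_fun (inv_sec_res _ _ (rs_preimS h)) (inv_sec_res _ _ (rs_preimS (rs_preimS h))).
set x := inv_sec v (inv_sec g s).
change (mres (@canon_sub V) (mres (rs_preimS (rs_preimS h)) x) =
        mres (rs_preimS (rs_preimS h)) (mres (@canon_sub U) x)).
by rewrite !mresE; exact: mres_irr.
Qed.

Definition canon :
    modHom (inverse_image u (inverse_image f M)) (inverse_image v (inverse_image g M)) :=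
  pb_lift (inverse_image u (inverse_image f M))
    (pb_lift (inverse_image f M) (ModHom canon_linear canon_res)).

Lemma canonE V (s : msec M V) :
  canon _ (inv_sec u (inv_sec f s)) = mres (@canon_sub V) (inv_sec v (inv_sec g s)).
Proof. by rewrite pb_liftE; exact: (pb_liftE (ModHom canon_linear canon_res)). Qed.

End Canonical.

Lemma inv_sec_ext2 (T A X : ringedSpace) (f : rsHom A X) (u : rsHom T A) (M : omodule X)
    (N : omodule T) (g h : modHom (inverse_image u (inverse_image f M)) N) :
  (forall V (s : msec M V), g _ (inv_sec u (inv_sec f s)) = h _ (inv_sec u (inv_sec f s))) ->
  g =m h.
Proof.
move=> e; apply: inv_sec_ext.
pose p (k : modHom (inverse_image u (inverse_image f M)) N) :=
  push_hom u k \oM pb_unit (inverse_image u (inverse_image f M)).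
by have : p g =m p h by apply: inv_sec_ext => V s; exact: e.
Qed.

Lemma inv_sec_ext3 (T A B X : ringedSpace) (f : rsHom A X) (u : rsHom B A)
    (v : rsHom T B) (M : omodule X) (N : omodule T)
    (g h : modHom (inverse_image v (inverse_image u (inverse_image f M))) N) :
  (forall V (s : msec M V), g _ (inv_sec v (inv_sec u (inv_sec f s))) =
                            h _ (inv_sec v (inv_sec u (inv_sec f s)))) ->
  g =m h.
Proof.
move=> e; apply: inv_sec_ext.
pose p (k : modHom (inverse_image v (inverse_image u (inverse_image f M))) N) :=
  push_hom v k \oM pb_unit (inverse_image v (inverse_image u (inverse_image f M))).
by have : p g =m p h by apply: inv_sec_ext2 => V s; exact: e.
Qed.

Lemma canon_iso (T A B X : ringedSpace) (f : rsHom A X) (u : rsHom T A)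
    (g : rsHom B X) (v : rsHom T B) (e : f \oR u =r g \oR v) (M : omodule X) :
  mh_iso (canon e M).
Proof.
exists (canon (rs_eq_sym e) M); split; apply: inv_sec_ext2 => V s /=;
  by rewrite canonE mh_res canonE mresE mres_id.
Qed.

Section InvMapTheory.
Variables (X Y : ringedSpace) (f : rsHom X Y).

Lemma inv_map_id (M : omodule Y) (h : modHom M M) :
  h =m mh_id M -> inv_map f h =m mh_id _.
Proof. by move=> e; apply: inv_sec_ext => V s; rewrite inv_mapE e. Qed.

Lemma inv_map_comp (M N P : omodule Y) (g : modHom N P) (h : modHom M N) :
  inv_map f g \oM inv_map f h =m inv_map f (g \oM h).
Proof. by apply: inv_sec_ext => V s; rewrite /= !inv_mapE. Qed.

Lemma inv_map_congr (M N : omodule Y) (g h : modHom M N) :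
  g =m h -> inv_map f g =m inv_map f h.
Proof. by move=> e; apply: inv_sec_ext => V s; rewrite !inv_mapE e. Qed.

Lemma inv_map_iso (M N : omodule Y) (h : modHom M N) :
  mh_iso h -> mh_iso (inv_map f h).
Proof.
move=> [g [gh hg]]; exists (inv_map f g).
by split=> U s; rewrite inv_map_comp inv_map_id.
Qed.

End InvMapTheory.

(** ** Inverse images of invertible sheaves are invertible *)

(* The direct image of N|_W, with sections N(U \cap W) over [U]. *)
Section Trunc.
Variables (X : ringedSpace) (W : opens X) (N : omodule X).

Definition trunc_sec (U : opens X) : lmodType (sec U) :=
  restrict_scalars (res (@oIl _ U W)) (msec N (oI U W)).

Lemma oIS (U V : opens X) : osub V U -> osub (oI V W) (oI U W).
Proof. by move=> h x [/h]. Qed.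

Definition trunc_res (U V : opens X) (h : osub V U) (s : trunc_sec U) : trunc_sec V :=
  mres (oIS h) (s : msec N (oI U W)).

Lemma trunc_linear (U V : opens X) (h : osub V U) (a : sec U) (u v : trunc_sec U) :
  trunc_res h (a *: u + v) = res h a *: trunc_res h u + trunc_res h v.
Proof.
apply: etrans (mres_linear _ _ _ _) _; congr (_ *: _ + _).
by rewrite !resE; exact: res_irr.
Qed.

Lemma trunc_id (U : opens X) (h : osub U U) (s : trunc_sec U) : trunc_res h s = s.
Proof. exact: mres_id. Qed.

Lemma trunc_comp (U V V' : opens X) (h : osub V U) (k : osub V' V) (l : osub V' U)
  (s : trunc_sec U) : trunc_res k (trunc_res h s) = trunc_res l s.
Proof. exact: mres_comp. Qed.

Lemma trunc_sheaf : is_sheaf trunc_res.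
Proof.
move=> U I V h cov s comp.
apply: (@mres_sheaf _ N (oI U W) I (fun i => oI (V i) W) (fun i => oIS (h i)) _ s).
  by move=> x [/cov[i Vx] Wx]; exists i.
move=> i j; move: (comp i j); rewrite /trunc_res => e.
have k : osub (oI (oI (V i) W) (oI (V j) W)) (oI (oI (V i) (V j)) W).
  by move=> x [[? ?] [? ?]].
by have := congr1 (mres k) e; rewrite !mresE (mres_irr _ (@oIl _ _ _))
  (mres_irr _ (@oIr _ _ _)).
Qed.

Definition trunc : omodule X :=
  OModule trunc_linear trunc_id trunc_comp trunc_sheaf.

Lemma trunc_unit_linear (U : opens X) :
  linear (fun s : msec N U => mres (@oIl _ U W) s : msec trunc U).
Proof. by move=> a s t; rewrite mres_linear. Qed.

Lemma trunc_unit_res (U V : opens X) (h : osub V U) (s : msec N U) :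
  (mres (@oIl _ V W) (mres h s) : msec trunc V) =
  mres h (mres (@oIl _ U W) s : msec trunc U).
Proof.
change (mres (@oIl _ V W) (mres h s) = mres (oIS h) (mres (@oIl _ U W) s)).
by rewrite !mresE; exact: mres_irr.
Qed.

Definition trunc_unit : modHom N trunc := ModHom trunc_unit_linear trunc_unit_res.

End Trunc.

Section InvertibleInverseImage.
Variables (X Y : ringedSpace) (f : rsHom X Y) (L : omodule Y).
Variables (W : opens Y) (F : modHomOn W (ostr Y) L).
Hypothesis Fbij : forall U (h : osub U W), bijective (@mho_fun _ _ _ _ F U h).

Let FI V : bijective (@mho_fun _ _ _ _ F (oI V W) (@oIr _ V W)) := Fbij _.

Let W' := rs_preim f W.

Let gen : msec L W := F W (osub_refl (U := W)) (1 : sec W).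

Lemma F_gen U (h : osub U W) (a : sec U) : F U h a = a *: mres h gen.
Proof.
rewrite /gen -(mho_res _ (osub_refl (U := W)) h).
have -> : mres h (1 : msec (ostr Y) W) = 1 :> sec U by exact: rmorph1.
have l := mho_linear F h; have F0 : F U h 0 = 0.
  have := l (-1) 0 0; rewrite scaler0 addr0 => e.
  by rewrite [LHS]e scaleN1r addNr.
have := l a (1 : sec U) 0; rewrite F0 !addr0 => <-; congr (F U h _).
by apply: esym; exact: mulr1.
Qed.

Lemma gen_inj U (h : osub U W) (a b : sec U) :
  a *: mres h gen = b *: mres h gen -> a = b.
Proof. by rewrite -!F_gen; exact: (bij_inj (Fbij h)). Qed.

Lemma coef_ex V (s : msec L V) :
  exists a : sec (oI V W), mres (@oIl _ V W) s = a *: mres (@oIr _ V W) gen.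
Proof.
have [G GF FG] := FI V.
by exists (G (mres (@oIl _ V W) s)); rewrite -F_gen FG.
Qed.

Definition coef V (s : msec L V) : sec (oI V W) := sval (cid (coef_ex s)).

Lemma coefP V (s : msec L V) :
  mres (@oIl _ V W) s = coef s *: mres (@oIr _ V W) gen.
Proof. by rewrite /coef; case: cid. Qed.

Lemma coef_linear V (a : sec V) (s t : msec L V) :
  coef (a *: s + t) = res (@oIl _ V W) a * coef s + coef t.
Proof.
by apply: (gen_inj (h := @oIr _ V W)); rewrite -coefP mres_linear !coefP scalerDl scalerA.
Qed.

Lemma coef_res U V (h : osub V U) (s : msec L U) :
  coef (mres h s) = res (oIS (W := W) h) (coef s).
Proof.
apply: (gen_inj (h := @oIr _ V W)); rewrite -coefP.
have := congr1 (mres (oIS (W := W) h)) (coefP s).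
rewrite mresZ !mresE (mres_irr (@oIr _ V W) (osub_trans (oIS (W := W) h) (@oIr _ U W))) => <-.
exact: mres_irr.
Qed.

Lemma coef_gen : coef gen = 1.
Proof.
apply: (gen_inj (h := @oIr _ W W)); rewrite -coefP scale1r.
exact: mres_irr.
Qed.

Let cofun_sub V : osub (oI (rs_preim f V) W') (rs_preim f (oI V W)).
Proof. by []. Qed.

Definition cofun V (s : msec L V) : msec (pushforward f (trunc W' (ostr X))) V :=
  res (@cofun_sub V) (rs_sharp f _ (coef s)).

Lemma cofun_linear V : linear (@cofun V).
Proof.
move=> a s t; rewrite /cofun coef_linear !rmorphD !rmorphM.
rewrite (rs_sharp_res _ (rs_preimS (@oIl _ V W))) resE.
congr (_ * _ + _); change (res (osub_trans (@cofun_sub V) (rs_preimS (@oIl _ V W)))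
  (rs_sharp f V a) = res (@oIl _ (rs_preim f V) W') (rs_sharp f V a)).
exact: res_irr.
Qed.

Lemma cofun_res U V (h : osub V U) (s : msec L U) :
  cofun (mres h s) = mres h (cofun s).
Proof.
rewrite /cofun coef_res (rs_sharp_res _ (rs_preimS (oIS h))).
change (res (@cofun_sub V) (res (rs_preimS (oIS h)) (rs_sharp f _ (coef s))) =
        res (oIS (W := W') (rs_preimS h)) (res (@cofun_sub U) (rs_sharp f _ (coef s)))).
by rewrite !resE; exact: res_irr.
Qed.

Definition cohom : modHom L (pushforward f (trunc W' (ostr X))) :=
  ModHom cofun_linear cofun_res.

Let fL := inverse_image f L.
Let c : modHom fL (trunc W' (ostr X)) := pb_lift fL cohom.
Let c' U (x : msec fL U) : sec (oI U W') := c U x.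
Let gen' : msec fL W' := inv_sec f gen.

Definition reco_fun U (x : msec fL U) : msec (trunc W' fL) U :=
  c' x *: mres (@oIr _ U W') gen'.

Lemma reco_linear U : linear (@reco_fun U).
Proof.
move=> a x y; rewrite /reco_fun.
have -> : c' (a *: x + y) = res (@oIl _ U W') a * c' x + c' y.
  exact: (mh_linear c).
by rewrite scalerDl -scalerA.
Qed.

Lemma c'_res U V (h : osub V U) (x : msec fL U) :
  c' (mres h x) = res (oIS (W := W') h) (c' x).
Proof. exact: (mh_res c). Qed.

Lemma reco_res U V (h : osub V U) (x : msec fL U) :
  reco_fun (mres h x) = mres h (reco_fun x).
Proof.
rewrite /reco_fun c'_res.
change (res (oIS (W := W') h) (c' x) *: mres (@oIr _ V W') gen' =
  mres (oIS (W := W') h) (c' x *: mres (@oIr _ U W') gen')).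
by rewrite mresZ mresE; congr (_ *: _); exact: mres_irr.
Qed.

Definition reco : modHom fL (trunc W' fL) := ModHom reco_linear reco_res.

Lemma c'_inv_sec V (s : msec L V) :
  c' (inv_sec f s) = res (@cofun_sub V) (rs_sharp f _ (coef s)).
Proof. exact: (pb_liftE cohom s). Qed.

Lemma recoE : reco =m trunc_unit W' fL.
Proof.
apply: inv_sec_ext => V s.
change (c' (inv_sec f s) *: mres (@oIr _ (rs_preim f V) W') gen' =
  mres (@oIl _ (rs_preim f V) W') (inv_sec f s)).
rewrite c'_inv_sec.
have := congr1 (fun t => mres (@cofun_sub V) (inv_sec f t)) (coefP s).
rewrite /= (inv_sec_res _ _ (rs_preimS (@oIl _ V W))) inv_secZ mresZ.
rewrite (inv_sec_res _ _ (rs_preimS (@oIr _ V W))) !mresE => e.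
apply: etrans (esym (etrans _ e)); last exact: mres_irr.
by congr (_ *: _); exact: mres_irr.
Qed.

Let trivW U (h : osub U W') (a : sec U) : msec fL U := a *: mres h gen'.

Let trivW_linear U (h : osub U W') :
  linear (trivW h : msec (ostr X) U -> msec fL U).
Proof. by move=> a x y; rewrite /trivW scalerDl -scalerA. Qed.

Let trivW_res U V (k : osub U W') (l : osub V W') (h : osub V U)
  (s : msec (ostr X) U) : trivW l (mres h s) = mres h (trivW k s).
Proof.
by rewrite /trivW mresZ mresE; congr (_ *: _); exact: mres_irr.
Qed.

Lemma invertible_at_inverse_image :
  exists F' : modHomOn W' (ostr X) fL, forall U (h : osub U W'), bijective (F' U h).
Proof.
exists (ModHomOn trivW_linear trivW_res) => U h /=.
have k : osub U (oI U W') by move=> x Ux; split=> //; exact: h.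
exists (fun x => res k (c' x)) => [a|x].
  rewrite /trivW.
  have -> : c' (a *: mres h gen') = res (@oIl _ U W') a * c' (mres h gen').
    exact: (mhZ c).
  rewrite c'_res c'_inv_sec coef_gen !rmorph1 mulr1 resE.
  exact: res_id.
rewrite /trivW.
have : mres k (reco_fun x : msec fL (oI U W')) = mres k (mres (@oIl _ U W') x).
  by congr (mres k _); exact: recoE.
rewrite /reco_fun mresZ !mresE mres_id => e.
by apply: etrans e; congr (_ *: _); exact: mres_irr.
Qed.

End InvertibleInverseImage.

Lemma invertible_inverse_image (X Y : ringedSpace) (f : rsHom X Y) (L : omodule Y) :
  invertible L -> invertible (inverse_image f L).
Proof.
move=> inv x; have [W [Wx [F Fb]]] := inv (f x).
by exists (rs_preim f W); split=> //; exact: invertible_at_inverse_image Fb.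
Qed.

(** ** Picard groups *)

Record invSheaf (X : ringedSpace) := InvSheaf {
  iv_mod :> omodule X;
  iv_inv : invertible iv_mod }.

Definition inv_isom (X : ringedSpace) (L L' : invSheaf X) : Prop :=
  exists f : modHom L L', mh_iso f.

(* A G-linearized invertible sheaf: an invertible sheaf [M] with an isomorphism
   lambda : a^* M -> p_2^* M such that
   (m x 1)^* lambda = p_23^* lambda o (1 x a)^* lambda on G x G x X, with the
   canonical identifications of the sources and targets:
     (m x 1)^* a^* M = (1 x a)^* a^* M,  (1 x a)^* p_2^* M = p_23^* a^* M,
     (m x 1)^* p_2^* M = p_23^* p_2^* M. *)
Record linSheaf (S : scheme) (G : groupScheme S) (X : GScheme G) := LinSheaf {
  ls_mod :> invSheaf X;
  ls_lin : modHom (inverse_image (ga_act X) ls_mod) (inverse_image (ga_p2 X) ls_mod);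
  ls_iso : mh_iso ls_lin;
  ls_cocycle :
    canon (ga_mul1_p2 X) ls_mod \oM inv_map (ga_mul1 X) ls_lin =m
    inv_map (ga_p23 X) ls_lin \oM canon (ga_1act_p2 X) ls_mod \oM
      inv_map (ga_1act X) ls_lin \oM canon (ga_mul1_act X) ls_mod }.

Definition lin_isom (S : scheme) (G : groupScheme S) (X : GScheme G)
    (M N : linSheaf X) : Prop :=
  exists2 f : modHom M N, mh_iso f &
    ls_lin N \oM inv_map (ga_act X) f =m inv_map (ga_p2 X) f \oM ls_lin M.

Record classes (T : Type) (R : T -> T -> Prop) := Classes {
  cl_mem :> T -> Prop;
  cl_ex : exists x, cl_mem = R x }.

(* Only the underlying sets of the groups Pic(X) and Pic(G, X): the group laws
   play no role in the injectivity of phi^*. *)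
Definition Pic (X : ringedSpace) := classes (@inv_isom X).
Definition PicG (S : scheme) (G : groupScheme S) (X : GScheme G) :=
  classes (@lin_isom S G X).

Lemma mh_iso_comp (X : ringedSpace) (M N P : omodule X)
    (g : modHom N P) (f : modHom M N) :
  mh_iso g -> mh_iso f -> mh_iso (g \oM f).
Proof.
move=> [g' [gK Kg]] [f' [fK Kf]]; exists (f' \oM g'); split=> U s /=.
  by rewrite [g' _ _](gK U) /= [LHS](fK U).
by rewrite [f _ _](Kf U) /= [LHS](Kg U).
Qed.

Lemma inv_isom_refl (X : ringedSpace) (L : invSheaf X) : inv_isom L L.
Proof. by exists (mh_id L); exists (mh_id L). Qed.

Lemma inv_isom_sym (X : ringedSpace) (L L' : invSheaf X) :
  inv_isom L L' -> inv_isom L' L.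
Proof. by move=> [f [g [gf fg]]]; exists g; exists f. Qed.

Lemma inv_isom_trans (X : ringedSpace) (L L' L'' : invSheaf X) :
  inv_isom L L' -> inv_isom L' L'' -> inv_isom L L''.
Proof. by move=> [f fi] [g gi]; exists (g \oM f); exact: mh_iso_comp. Qed.

Section LinIsom.
Variables (S : scheme) (G : groupScheme S) (X : GScheme G).

Lemma lin_isom_refl (M : linSheaf X) : lin_isom M M.
Proof.
exists (mh_id M); first by exists (mh_id M).
by move=> U s; rewrite /= !inv_map_id.
Qed.

Lemma lin_isom_sym (M N : linSheaf X) : lin_isom M N -> lin_isom N M.
Proof.
move=> [f [g [gf fg]] e]; exists g; first by exists f.
move=> U s /=.
have fgs : inv_map (ga_act X) f _ (inv_map (ga_act X) g _ s) = s.
  by rewrite [LHS](inv_map_comp f g) inv_map_id.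
have := congr1 (fun t => inv_map (ga_p2 X) g _ t) (e _ (inv_map (ga_act X) g _ s)).
by rewrite /= fgs => ->; rewrite [RHS](inv_map_comp g f) inv_map_id.
Qed.

Lemma lin_isom_trans (M N P : linSheaf X) :
  lin_isom M N -> lin_isom N P -> lin_isom M P.
Proof.
move=> [f fi ef] [g gi eg]; exists (g \oM f); first exact: mh_iso_comp.
move=> U s /=; rewrite -!inv_map_comp /= [LHS](eg _ _) /=.
by congr (inv_map _ _ _ _); exact: ef.
Qed.

End LinIsom.

(** ** The map phi^* : Pic(Y) -> Pic(G, X) *)

Definition inv_pullback (X Y : ringedSpace) (f : rsHom X Y) (L : invSheaf Y) :
  invSheaf X := InvSheaf (invertible_inverse_image f (@iv_inv _ L)).

Section Pullback.
Variables (S : scheme) (G : groupScheme S) (X : GScheme G) (Y : overScheme S).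
Variables (phi : overHom X Y) (phi_inv : G_invariant phi).

(* a^* phi^* L = (phi a)^* L = (phi p_2)^* L = p_2^* phi^* L *)
Definition pullback_lin (L : invSheaf Y) :
  modHom (inverse_image (ga_act X) (inv_pullback phi L))
         (inverse_image (ga_p2 X) (inv_pullback phi L)) := canon phi_inv L.

Lemma pullback_cocycle (L : invSheaf Y) :
    canon (ga_mul1_p2 X) (inv_pullback phi L) \oM inv_map (ga_mul1 X) (pullback_lin L) =m
    inv_map (ga_p23 X) (pullback_lin L) \oM
      canon (ga_1act_p2 X) (inv_pullback phi L) \oM
      inv_map (ga_1act X) (pullback_lin L) \oM
      canon (ga_mul1_act X) (inv_pullback phi L).
Proof.
apply: inv_sec_ext3 => V s.
rewrite /= !inv_mapE /pullback_lin canonE (inv_sec_res _ _ (rs_preimS (@canon_sub _ _ _ _ _ _ _ _ phi_inv V))) !mh_res canonE.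
rewrite canonE !mh_res inv_mapE canonE.
rewrite (inv_sec_res _ _ (rs_preimS (@canon_sub _ _ _ _ _ _ _ _ phi_inv V))) !mh_res canonE.
rewrite !mh_res inv_mapE canonE.
rewrite (inv_sec_res _ _ (rs_preimS (@canon_sub _ _ _ _ _ _ _ _ phi_inv V))).
by rewrite !mresE; exact: mres_irr.
Qed.

Definition phi_pull (L : invSheaf Y) : linSheaf X :=
  @LinSheaf S G X (inv_pullback phi L) (pullback_lin L) (canon_iso phi_inv L)
    (@pullback_cocycle L).

Lemma phi_pull_isom (L L' : invSheaf Y) :
  inv_isom L L' -> lin_isom (phi_pull L) (phi_pull L').
Proof.
move=> [f fi]; exists (inv_map phi f); first exact: inv_map_iso.
apply: inv_sec_ext2 => V s.
by rewrite /= /pullback_lin !inv_mapE !canonE mh_res !inv_mapE.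
Qed.

Definition pullback_class (c : Pic Y) : linSheaf X -> Prop :=
  fun M => exists2 L, cl_mem c L & lin_isom (phi_pull L) M.

Lemma pullback_class_ex (c : Pic Y) :
  exists M, pullback_class c = lin_isom M.
Proof.
have [L cL] := cl_ex c; exists (phi_pull L).
apply/funext => M; apply/propext; split=> [[L']|LM].
  by rewrite cL => /phi_pull_isom; exact: lin_isom_trans.
by exists L => //; rewrite cL; exact: inv_isom_refl.
Qed.

Definition Pic_pullback (c : Pic Y) : PicG X := Classes (pullback_class_ex c).

End Pullback.

(* Main.v *)
Require Import Defs.
From mathcomp Require Import all_boot all_algebra.
From mathcomp Require Import all_classical.
From mathcomp Require Import topology.

(** An invertible sheaf [L] on [Y] can be recovered from its inverse image
    together with the identification of [a^* phi^* L] with [p_2^* phi^* L]: the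
    unit L -> phi_* phi^* L identifies [L] with the subsheaf of those sections
    [t] of phi^* L for which [a^* t] corresponds to [p_2^* t].  This is local on
    [Y].  Where [L] has a frame [e], the section phi^* e is a frame of phi^* L,
    so t = u phi^* e for a unique function [u]; since p_2^* phi^* e is again a
    frame, [t] is invariant exactly when a^* u = p_2^* u, that is, when [u] is an
    invariant function, and by hypothesis such a [u] is phi^* b for a unique
    function [b] on [Y]; hence [t] is the inverse image of [b e] and of no other
    section.  Because of this uniqueness the local solutions glue
    ([inv_sec_inj], [invariant_descends]).

    A morphism phi^* L -> phi^* L' which commutes with the linearizations maps
    invariant sections to invariant sections, hence is the inverse image of a
    morphism L -> L' ([modHom_descends]).  An isomorphism and its inverse both
    descend, and by uniqueness the descended morphisms are mutually inverse.

    The descent is carried out for two maps of ringed spaces a, p : T -> X that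
    become equal after f : X -> Y, functions on [Y] being those functions on [X]
    whose inverse images under [a] and [p] agree; for the theorem, [T] is
    G x X. *)

Set Implicit Arguments.
Unset Strict Implicit.
Unset Printing Implicit Defensive.

Import GRing.Theory.
Local Open Scope ring_scope.

(** * Frames of modules *)

Definition is_frame (X : ringedSpace) (M : omodule X) (W : opens X)
    (e : msec M W) : Prop :=
  forall U (h : osub U W), bijective (fun a : sec U => a *: mres h e).

Section Frames.
Variables (X : ringedSpace) (M : omodule X).
Implicit Types U V W : opens X.

Lemma frame_res W (e : msec M W) : is_frame e ->
  forall V (h : osub V W), is_frame (mres h e).
Proof.
move=> fe V h U k; apply: eq_bij (fe U (osub_trans k h)) _ _ => a /=.
by rewrite mresE.
Qed.

Lemma frame_inj W (e : msec M W) : is_frame e ->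
  forall U (h : osub U W) (a b : sec U),
  a *: mres h e = b *: mres h e -> a = b.
Proof. by move=> fe U h a b; exact: (bij_inj (fe U h)). Qed.

Lemma frame_gen W (e : msec M W) : is_frame e ->
  forall s : msec M W, exists a : sec W, s = a *: e.
Proof.
move=> fe s; have [g _ gK] := fe W (osub_refl (U := W)).
by exists (g s); rewrite -[LHS]gK mres_id.
Qed.

Lemma invertible_frame : invertible M ->
  forall x : X, exists W (e : msec M W), oset W x /\ is_frame e.
Proof.
move=> inv x; have [W [Wx [F Fb]]] := inv x.
exists W, (F W (osub_refl (U := W)) (1 : sec W)); split=> // U h.
by apply: eq_bij (Fb U h) _ _ => a; exact: F_gen.
Qed.

Lemma invertible_frame_in : invertible M -> forall V (x : X), oset V x ->
  exists W (h : osub W V) (e : msec M W), oset W x /\ is_frame e.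
Proof.
move=> inv V x Vx; have [W [e [Wx fe]]] := invertible_frame inv x.
exists (oI V W), (@oIl _ V W), (mres (@oIr _ V W) e); split=> //.
exact: frame_res.
Qed.

Section FrameHom.
Variables (W : opens X) (e : msec M W) (fe : is_frame e).

Definition frame_fun U (h : osub U W) (a : msec (ostr X) U) : msec M U :=
  (a : sec U) *: mres h e.

Lemma frame_linear U (h : osub U W) : linear (frame_fun h).
Proof. by move=> a x y; rewrite /frame_fun scalerDl -scalerA. Qed.

Lemma frame_fun_res U V (k : osub U W) (l : osub V W) (h : osub V U)
  (s : msec (ostr X) U) : frame_fun l (mres h s) = mres h (frame_fun k s).
Proof.
by rewrite /frame_fun mresZ mresE; congr (_ *: _); exact: mres_irr.
Qed.

Definition frame_hom : modHomOn W (ostr X) M :=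
  ModHomOn frame_linear frame_fun_res.

Lemma frame_hom_bij U (h : osub U W) : bijective (frame_hom U h).
Proof. exact: fe. Qed.

Lemma frame_hom1 : frame_hom W (osub_refl (U := W)) (1 : sec W) = e.
Proof. by rewrite /= /frame_fun scale1r mres_id. Qed.

End FrameHom.
End Frames.

(** The coordinate of sections of [L] along [e] gives, by adjunction, a morphism
    from f^* L to the functions on the preimage of [W]; it takes the value 1 at
    f^* e, and multiplying it by f^* e gives back the identity, because this
    holds for sections of the form f^* s. *)
Lemma frame_inv_sec (X Y : ringedSpace) (f : rsHom X Y) (L : omodule Y)
    (W : opens Y) (e : msec L W) :
  is_frame e -> is_frame (inv_sec f e).
Proof.
move=> fe U h.
pose c := pb_lift (inverse_image f L) (cohom f (frame_hom_bij fe)).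
have k : osub U (oI U (rs_preim f W)) by move=> x Ux; split=> //; exact: h.
pose c' V (x : msec (inverse_image f L) V) : sec (oI V (rs_preim f W)) := c V x.
exists (fun x => res k (c' U x)) => [a|x] /=.
  have -> : c' U (a *: mres h (inv_sec f e)) =
      res (@oIl _ U (rs_preim f W)) a * c' U (mres h (inv_sec f e)).
    exact: (mhZ c).
  have -> : c' U (mres h (inv_sec f e)) = res (oIS (W := rs_preim f W) h) (c' _ (inv_sec f e)).
    exact: (mh_res c).
  have -> : c' _ (inv_sec f e) = 1.
    rewrite /c' /c pb_liftE /= /cofun.
    have -> : coef (frame_hom_bij fe) e = 1.
      rewrite -[RHS](coef_gen (frame_hom_bij fe)).
      by congr (coef _ _); rewrite frame_hom1.
    by rewrite !rmorph1.
  by rewrite rmorph1 mulr1 resE res_id.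
have := congr1 (mres k) (recoE (f := f) (frame_hom_bij fe) x).
rewrite /= /reco_fun frame_hom1 => E.
have := etrans (esym (@mresZ _ (inverse_image f L) _ _ k _ _)) E.
rewrite !mresE mres_id => {}E.
by apply: etrans E; congr (_ *: _); exact: mres_irr.
Qed.

(** * Descent along two maps which become equal *)

Section Descent.
Variables (T X Y : ringedSpace) (a p : rsHom T X) (f : rsHom X Y).
Hypothesis e : f \oR a =r f \oR p.
Hypothesis f_inj : forall V, injective (rs_sharp f V).
Hypothesis f_im : forall V (u : sec (rs_preim f V)),
  sec_eq (rs_sharp a _ u) (rs_sharp p _ u) -> exists b, rs_sharp f V b = u.

Let sub V := @canon_sub _ _ _ _ _ _ _ _ e V.

(** For the two maps of a group action this says that [t] is fixed by [G] for
    the linearization of phi^* L that comes from phi a = phi p_2. *)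
Definition lin_invariant (L : omodule Y) V
    (t : msec (inverse_image f L) (rs_preim f V)) : Prop :=
  Defs.canon e L _ (inv_sec a t) = mres (@sub V) (inv_sec p t).

Lemma lin_invariant_res (L : omodule Y) V W (h : osub W V)
    (k : osub (rs_preim f W) (rs_preim f V))
    (t : msec (inverse_image f L) (rs_preim f V)) :
  lin_invariant t -> lin_invariant (mres k t).
Proof.
rewrite /lin_invariant (inv_sec_res _ _ (rs_preimS k)) mh_res => ->.
by rewrite (inv_sec_res _ _ (rs_preimS k)) !mresE; exact: mres_irr.
Qed.

Lemma lin_invariant_inv_sec (L : omodule Y) V (s : msec L V) :
  lin_invariant (inv_sec f s).
Proof. exact: canonE. Qed.

Lemma lin_invariant_map (L L' : omodule Y)
    (g : modHom (inverse_image f L) (inverse_image f L')) :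
  Defs.canon e L' \oM inv_map a g =m inv_map p g \oM Defs.canon e L ->
  forall V (t : msec (inverse_image f L) (rs_preim f V)),
    lin_invariant t -> lin_invariant (g _ t).
Proof.
move=> ge V t inv_t; have := ge _ (inv_sec a t).
by rewrite /= inv_mapE inv_t mh_res inv_mapE.
Qed.

Lemma inv_sec_inj_frame (L : omodule Y) V (l : msec L V) : is_frame l ->
  injective (fun s : msec L V => inv_sec f s).
Proof.
move=> fl s t /=; have [b ->] := frame_gen fl s; have [c ->] := frame_gen fl t.
rewrite !inv_secZ => E; congr (_ *: _); apply: f_inj.
apply: (frame_inj (h := osub_refl (U := rs_preim f V)) (frame_inv_sec fl)).
by rewrite mres_id.
Qed.

(** In t = u f^* l the coefficient [u] satisfies a^* u = p^* u, because
    comparing both sides of the invariance of [t] amounts to comparing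
    coefficients of the frame p^* f^* l; so [u] is a function on [Y]. *)
Lemma invariant_descends_frame (L : omodule Y) V (l : msec L V) : is_frame l ->
  forall t : msec (inverse_image f L) (rs_preim f V),
    lin_invariant t -> exists s : msec L V, inv_sec f s = t.
Proof.
move=> fl t; have [u ->] := frame_gen (frame_inv_sec (f := f) fl) t.
rewrite /lin_invariant !inv_secZ mhZ mresZ canonE => E.
have [|b <-] := @f_im V u; last by exists (b *: l); rewrite inv_secZ.
apply: sec_eq_sym; split.
  exact: (@canon_sub _ _ _ _ _ _ _ _ (rs_eq_sym e) V).
exists (@sub V); apply: esym.
exact: (frame_inj (frame_inv_sec (f := p) (frame_inv_sec (f := f) fl)) E).
Qed.

Section Invertible.
Variable L : omodule Y.
Hypothesis Linv : invertible L.

Lemma inv_sec_inj V : injective (fun s : msec L V => inv_sec f s).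
Proof.
move=> s t /= E; apply: mres_sep => y Vy.
have [W [h [l [Wy fl]]]] := invertible_frame_in Linv Vy.
exists W, h; split=> //; apply: (inv_sec_inj_frame fl).
by rewrite /= !(inv_sec_res _ _ (rs_preimS h)) E.
Qed.

(** The local descents of [t] agree on overlaps because a section of [L] is
    determined by its inverse image. *)
Lemma invariant_descends V (t : msec (inverse_image f L) (rs_preim f V)) :
  lin_invariant t -> exists s : msec L V, inv_sec f s = t.
Proof.
move=> inv_t.
(* the cover consists of all open subsets over which [t] already descends *)
pose I := {W : opens Y & {h : osub W V &
  {s : msec L W | inv_sec f s = mres (rs_preimS h) t}}}.
pose h (i : I) : osub (projT1 i) V := projT1 (projT2 i).
pose s (i : I) : msec L (projT1 i) := sval (projT2 (projT2 i)).
have sP (i : I) : inv_sec f (s i) = mres (rs_preimS (h i)) t :=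
  svalP (projT2 (projT2 i)).
have cov y : oset V y -> exists i : I, oset (projT1 i) y.
  move=> Vy; have [W [k [l [Wy fl]]]] := invertible_frame_in Linv Vy.
  have [r rP] := invariant_descends_frame fl (lin_invariant_res k (rs_preimS k) inv_t).
  by exists (existT _ W (existT _ k (exist _ r rP))).
have [|r [rP _]] := mres_sheaf h cov (s := s).
  move=> i j; apply: inv_sec_inj => /=.
  rewrite (inv_sec_res _ _ (rs_preimS (@oIl _ _ _))) (inv_sec_res _ _ (rs_preimS (@oIr _ _ _))).
  by rewrite !sP !mresE; exact: mres_irr.
exists r; apply: mres_sep => x /cov[i Wx].
exists (rs_preim f (projT1 i)), (rs_preimS (h i)); split=> //.
by rewrite -(inv_sec_res _ _ (rs_preimS (h i))) rP sP.
Qed.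

End Invertible.

(** Sections of [L] have invariant inverse images, [g] preserves invariance, and
    invariant sections of f^* L' come from [L']; linearity and compatibility
    with restriction are checked after inverse image. *)
Lemma modHom_descends (L L' : omodule Y) : invertible L' ->
  forall g : modHom (inverse_image f L) (inverse_image f L'),
  Defs.canon e L' \oM inv_map a g =m inv_map p g \oM Defs.canon e L ->
  exists d : modHom L L', forall V (s : msec L V),
    inv_sec f (d V s) = g _ (inv_sec f s).
Proof.
move=> inv' g ge.
have ex V (s : msec L V) : exists s' : msec L' V, inv_sec f s' = g _ (inv_sec f s).
  apply: (invariant_descends inv'); apply: (lin_invariant_map ge).
  exact: lin_invariant_inv_sec.
pose d V (s : msec L V) : msec L' V := sval (cid (ex V s)).
have dP V (s : msec L V) : inv_sec f (d V s) = g _ (inv_sec f s) := svalP (cid (ex V s)).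
have d_lin V : linear (d V).
  move=> b s t; apply: (inv_sec_inj inv') => /=.
  by rewrite dP !inv_sec_linear mh_linear !dP.
have d_res U V (h : osub V U) (s : msec L U) : d V (mres h s) = mres h (d U s).
  apply: (inv_sec_inj inv') => /=.
  by rewrite dP !(inv_sec_res _ _ (rs_preimS h)) mh_res dP.
by exists (ModHom d_lin d_res).
Qed.

Lemma iso_descends (L L' : omodule Y) : invertible L -> invertible L' ->
  forall g : modHom (inverse_image f L) (inverse_image f L'), mh_iso g ->
  Defs.canon e L' \oM inv_map a g =m inv_map p g \oM Defs.canon e L ->
  exists d : modHom L L', mh_iso d.
Proof.
move=> inv inv' g [g' [g'K gK]] ge.
have ge' : Defs.canon e L \oM inv_map a g' =m inv_map p g' \oM Defs.canon e L'.
  move=> U s /=.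
  have ggs : inv_map a g _ (inv_map a g' _ s) = s.
    by rewrite [LHS](inv_map_comp g g') inv_map_id.
  have := congr1 (fun t => inv_map p g' _ t) (ge _ (inv_map a g' _ s)).
  by rewrite /= ggs => ->; rewrite [RHS](inv_map_comp g' g) inv_map_id.
have [d dP] := modHom_descends inv' ge; have [d' dP'] := modHom_descends inv ge'.
exists d, d'; split=> V s.
  by apply: (inv_sec_inj inv); rewrite /= dP' dP; exact: g'K.
by apply: (inv_sec_inj inv'); rewrite /= dP dP'; exact: gK.
Qed.

End Descent.

(** * Injectivity on Picard groups *)

Lemma classes_eq (T : Type) (R : T -> T -> Prop) (c c' : classes R) :
  cl_mem c = cl_mem c' -> c = c'.
Proof.
case: c c' => [m ex] [m' ex'] /= E; case: _ / E ex' => ex'.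
by rewrite (Prop_irrelevance ex ex').
Qed.

Lemma Pic_eq (X : ringedSpace) (c c' : Pic X) (L L' : invSheaf X) :
  cl_mem c L -> cl_mem c' L' -> inv_isom L L' -> c = c'.
Proof.
have [M cM] := cl_ex c; have [M' cM'] := cl_ex c'.
rewrite cM cM' => ML ML' LL'; apply: classes_eq; rewrite cM cM'.
have MM' : inv_isom M M'.
  exact: inv_isom_trans ML (inv_isom_trans LL' (inv_isom_sym ML')).
apply/funext => N; apply/propext; split; apply: inv_isom_trans => //.
exact: inv_isom_sym.
Qed.

Lemma phi_pull_isom_inv (S : scheme) (G : groupScheme S) (X : GScheme G)
    (Y : overScheme S) (phi : overHom X Y) (phi_inv : G_invariant phi) :
  invariants_iso phi -> forall L L' : invSheaf Y,
  lin_isom (phi_pull phi_inv L) (phi_pull phi_inv L') -> inv_isom L L'.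
Proof.
move=> phi_iso L L' [g gi ge].
apply: (iso_descends (e := phi_inv) _ _ _ _ gi ge).
- by move=> V; exact: (phi_iso V).1.
- by move=> V u /(phi_iso V).2.
- exact: iv_inv.
- exact: iv_inv.
Qed.

Theorem lemma3p11 (S : scheme) (G : groupScheme S) (X : GScheme G)
  (Y : overScheme S) (phi : overHom X Y) (phi_inv : G_invariant phi) :
  invariants_iso phi -> injective (Pic_pullback phi_inv).
Proof.
move=> phi_iso c c' cc'.
have [L cL] := cl_ex c; have cLL : cl_mem c L by rewrite cL; exact: inv_isom_refl.
have : cl_mem (Pic_pullback phi_inv c) (phi_pull phi_inv L).
  by exists L => //; exact: lin_isom_refl.
rewrite cc' => -[L' cL' /(phi_pull_isom_inv phi_iso) L'L].
exact: Pic_eq cLL cL' (inv_isom_sym L'L).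
Qed.
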